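(* Let $0\neq a\in\mathbb{C}$ and let $s\geq 2$ be an integer. Then the generalized Fibonacci polynomial $F_s(a,x)\in\mathbb{C}[x]$ has $s-1$ distinct complex roots, given by $$x_j=2\sqrt{a}\,\cos\frac{j\pi}{s},\qquad 1\leq j\leq s-1.$$
   Context: For fixed $0\neq a\in\mathbb{C}$, the generalized Fibonacci polynomials $F_s(a,x)\in\mathbb{C}[x]$ are defined recursively by $F_0(a,x)=0$, $F_1(a,x)=1$ and $F_{s+2}(a,x)=xF_{s+1}(a,x)-aF_s(a,x)$ for $s\geq 0$. The polynomial $F_s(a,x)$ has degree $s-1$ for $s\ge 1$. Here $\sqrt{a}$ denotes a fixed complex square root of $a$. *)

(* Defs.v *)
From HB Require Import structures.
From mathcomp Require Import all_boot all_order all_algebra.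
From mathcomp Require Import complex.
From mathcomp Require Import reals trigo.

Set Implicit Arguments.
Unset Strict Implicit.
Unset Printing Implicit Defensive.

Import Order.TTheory GRing.Theory Num.Theory.

Local Open Scope ring_scope.

Fixpoint gfib (K : comNzRingType) (a : K) (s : nat) : {poly K} :=
  match s with
  | 0%N => 0
  | s1.+1 =>
      match s1 with
      | 0%N => 1
      | s2.+1 => 'X * gfib a s1 - a *: gfib a s2
      end
  end.

(* Main.v *)
(** With [x = 2 r cos t] and [r ^ 2 = a], the recursion for the values
    [F_n(a, x) sin t] is the one satisfied by [r ^ (n - 1) sin (n t)], so the
    [s - 1] numbers [x_j] are roots of [F_s]. They are pairwise distinct because
    [cos] is injective on [[0, pi]], and [F_s] has degree [s - 1], so there is
    no other root. *)
Require Import Defs.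
From HB Require Import structures.
From mathcomp Require Import all_boot all_order all_algebra.
From mathcomp Require Import complex.
From mathcomp Require Import reals trigo.
From mathcomp Require Import ring.

Set Implicit Arguments.
Unset Strict Implicit.
Unset Printing Implicit Defensive.

Import Order.TTheory GRing.Theory Num.Theory.

Local Open Scope ring_scope.
Local Open Scope complex_scope.

Lemma gfibSS (K : comNzRingType) (a : K) n :
  gfib a n.+2 = 'X * gfib a n.+1 - a *: gfib a n.
Proof. by []. Qed.

(** The product by ['X] has size [n.+2], so subtracting a multiple of the shorter [gfib a n] cannot
    cancel its leading term. The induction carries two consecutive indices, as the recursion has
    order two. *)
Lemma size_gfib (K : comNzRingType) (a : K) n : size (gfib a n) = n.
Proof.
suff [] : size (gfib a n) = n /\ size (gfib a n.+1) = n.+1 by [].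
elim: n => [|n [IHn IHn1]]; first by rewrite size_poly0 size_poly1.
split=> //.
have sizeX : size ('X * gfib a n.+1) = n.+2.
  by rewrite mulrC size_mulX ?IHn1 // -size_poly_gt0 IHn1.
rewrite gfibSS size_polyDl sizeX // size_polyN.
by rewrite (leq_ltn_trans (size_scale_leq _ _)) // IHn.
Qed.

(** Keeping the factor [sin t] on the left avoids a division, so no condition on [t] arises.
    Starting at index [n.+1] makes the exponent of [r] exactly [n]. *)
Lemma gfib_horner_cos (R : realType) (r : R[i]) (t : R) n :
  (gfib (r ^+ 2) n.+1).[2 * r * (cos t)%:C] * (sin t)%:C =
  r ^+ n * (sin (n.+1%:R * t))%:C.
Proof.
suff [] : (gfib (r ^+ 2) n.+1).[2 * r * (cos t)%:C] * (sin t)%:C =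
            r ^+ n * (sin (n.+1%:R * t))%:C /\
          (gfib (r ^+ 2) n.+2).[2 * r * (cos t)%:C] * (sin t)%:C =
            r ^+ n.+1 * (sin (n.+2%:R * t))%:C by [].
set u := 2 * r * (cos t)%:C.
elim: n => [|n [IHn IHn1]].
  split; first by rewrite hornerC !mul1r.
  have -> : sin (2%:R * t) = 2 * cos t * sin t.
    by rewrite mulrDl mul1r sinD; ring.
  rewrite gfibSS hornerD hornerN hornerZ hornerM hornerX hornerC horner0.
  by rewrite !rmorphM rmorph_nat /u /=; ring.
split; first exact: IHn1.
(* Add the expansions of the sine at [n.+2%:R * t + t] and [n.+2%:R * t - t]: the cosine terms
   cancel. *)
have sin_rec : sin (n.+3%:R * t) =
    2 * cos t * sin (n.+2%:R * t) - sin (n.+1%:R * t).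
  have -> : n.+3%:R * t = n.+2%:R * t + t by rewrite -[n.+3]addn1 natrD; ring.
  have -> : n.+1%:R * t = n.+2%:R * t - t by rewrite -[n.+2]addn1 natrD; ring.
  by rewrite sinD sinB; ring.
rewrite gfibSS hornerD hornerN hornerZ hornerM hornerX mulrBl -(mulrA u) IHn1.
rewrite -(mulrA (r ^+ 2)) IHn !(exprS r) sin_rec rmorphB !rmorphM rmorph_nat /u.
by move: (r ^+ n) => rn /=; ring.
Qed.

Lemma sin_natpi (R : realType) n : sin (n%:R * pi) = 0 :> R.
Proof.
elim: n => [|n IHn]; first by rewrite mul0r sin0.
by rewrite -natr1 mulrDl mul1r sinDpi IHn oppr0.
Qed.

Theorem proposition4p2 (R : realType) (a sqrta : R[i]) (s : nat)
    (ha : a != 0) (hsqrta : sqrta ^+ 2 = a) (hs : (2 <= s)%N) :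
  let x (j : nat) : R[i] := 2 * sqrta * (cos (j%:R * pi / s%:R))%:C in
  (forall j k : nat, (1 <= j <= s - 1)%N -> (1 <= k <= s - 1)%N ->
     x j = x k -> j = k) /\
  (forall z : R[i], root (gfib a s) z <->
     exists j : nat, (1 <= j <= s - 1)%N /\ z = x j).
Proof.
move=> x.
have s_gt0 : (0 < s)%N by exact: ltnW hs.
have sR_gt0 : 0 < s%:R :> R by rewrite ltr0n.
have sqrta_neq0 : sqrta != 0.
  by apply: contraNneq ha => sqrta0; rewrite -hsqrta sqrta0 expr0n.
(* The angles lie strictly inside [(0, pi)]: this serves both the injectivity of [cos] and the
   nonvanishing of [sin]. *)
have arg_bounds j : (1 <= j <= s - 1)%N -> 0 < (j%:R * pi / s%:R : R) < pi.
  case/andP=> j_gt0 j_le; rewrite ?divr_gt0 ?mulr_gt0 ?ltr0n ?pi_gt0 //=.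
  rewrite ltr_pdivrMr // mulrC ltr_pM2l ?pi_gt0 // ltr_nat.
  by rewrite (leq_ltn_trans j_le) // subn1 ltn_predL.
have x_inj j k : (1 <= j <= s - 1)%N -> (1 <= k <= s - 1)%N -> x j = x k -> j = k.
  move=> /arg_bounds/andP[j_gt0 j_lt] /arg_bounds/andP[k_gt0 k_lt].
  have r2_neq0 : 2 * sqrta != 0 by rewrite mulf_neq0 // pnatr_eq0.
  move/(mulfI r2_neq0)/complexI/cos_inj.
  rewrite !in_itv /= !ltW // => /(_ isT isT).
  move/(mulIf (invr_neq0 (lt0r_neq0 sR_gt0)))/(mulIf (lt0r_neq0 (pi_gt0 R))).
  by move/eqP; rewrite eqr_nat => /eqP.
have root_x j : (1 <= j <= s - 1)%N -> root (gfib a s) (x j).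
  move=> /arg_bounds/sin_gt0_pi/lt0r_neq0 sin_neq0; apply/rootP.
  have sinC_neq0 : (sin (j%:R * pi / s%:R))%:C != 0 :> R[i].
    by rewrite (inj_eq (@complexI _) _ 0).
  (* It suffices to find zero after multiplying by the nonzero sine; for [t = j pi / s] the right
     side of [gfib_horner_cos] contains [sin (j pi)]. *)
  apply: (mulIf sinC_neq0); rewrite mul0r -hsqrta /x.
  have := gfib_horner_cos sqrta (j%:R * pi / s%:R) s.-1; rewrite prednK // => ->.
  by rewrite [s%:R * _]mulrC mulfVK ?lt0r_neq0 // sin_natpi mulr0.
split=> // z; split=> [root_z|[j [j_bounds ->]]]; last exact: root_x.
pose xs := [seq x j | j <- iota 1 (s - 1)].
have mem_iotaE j : (j \in iota 1 (s - 1)) = (1 <= j <= s - 1)%N.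
  by rewrite mem_iota add1n ltnS.
(* If [z] were not among the [s - 1] listed roots, [z :: xs] would give [s] distinct roots of a
   nonzero polynomial of size [s], one more than its degree. *)
have [/mapP[j] | z_notin] := boolP (z \in xs).
  by rewrite mem_iotaE => j_bounds ->; exists j.
have gfib_neq0 : gfib a s != 0 by rewrite -size_poly_gt0 size_gfib.
have all_roots : all (root (gfib a s)) (z :: xs).
  rewrite /= root_z /=; apply/allP=> _ /mapP[j + ->].
  by rewrite mem_iotaE; apply: root_x.
have uniq_roots : uniq (z :: xs).
  rewrite /= z_notin map_inj_in_uniq ?iota_uniq // => j k.
  by rewrite !mem_iotaE; apply: x_inj.
have := max_poly_roots gfib_neq0 all_roots uniq_roots.
by rewrite size_gfib /= size_map size_iota subn1 prednK ?ltnn.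
Qed.
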